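(* Let $a\in\mathbb{R}$, $T>0$, and let $\mathcal{G}_{\mathrm{adv}}$ and $\mu$ be as in the context. There exists $C>0$ such that for any $\epsilon\in(0,\tfrac12]$ there exists a (ReLU) FNO $\mathcal{N}^{\mathrm{FNO}}_\epsilon$ with grid size $N\le C\epsilon^{-1}$ such that \[ \mathbb{E}_{\bar u\sim\mu}\big[\|\mathcal{G}_{\mathrm{adv}}(\bar u)-\mathcal{N}^{\mathrm{FNO}}_\epsilon(\bar u)\|_{L^1(\mathbb{T})}\big]\le\epsilon, \] with Fourier cut-off $k_{\max}=1$, lifting dimension $d_v\le C$, $\mathrm{depth}(\mathcal{N}^{\mathrm{FNO}}_\epsilon)\le C\log(\epsilon^{-1})^2$ and $\mathrm{size}(\mathcal{N}^{\mathrm{FNO}}_\epsilon)\le C\log(\epsilon^{-1})^2$.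
   Context: $\mathbb{T}=\mathbb{R}/2\pi\mathbb{Z}$. Fix $0<\underline h\le\overline h$, $0<\underline w\le\overline w<2\pi$; $\mu$ is the law of $\bar u(x)=h\,1_{[-w/2,w/2]}(x-\xi)$ (periodized) with independent $h\sim\mathrm{Unif}[\underline h,\overline h]$, $w\sim\mathrm{Unif}[\underline w,\overline w]$, $\xi\sim\mathrm{Unif}[0,2\pi]$; $\mathcal{G}_{\mathrm{adv}}(\bar u)(x)=\bar u(x-aT)$. FNO with grid size $N$: let $x_j=2\pi j/N$, $j=1,\dots,N$, and for a (vector-valued) function $v$ on $\mathbb{T}$ let $\mathcal{F}_Nv(k)=\frac1N\sum_{j=1}^Nv(x_j)e^{-ikx_j}$. An FNO with lifting dimension $d_v$, Fourier cut-off $k_{\max}$, depth $L$ and ReLU activation $\sigma$ is $\mathcal{N}=Q\circ\mathcal{L}_L\circ\dots\circ\mathcal{L}_1\circ R$, where $(R\bar u)(x)=R(\bar u(x),x)$ with $R$ a shallow ReLU network into $\mathbb{R}^{d_v}$; $(\mathcal{L}_\ell v)(x)=\sigma\big(W_\ell v(x)+b_\ell(x)+(K_\ell v)(x)\big)$ with $W_\ell\in\mathbb{R}^{d_v\times d_v}$, $(K_\ell v)(x)=\sum_{|k|\le k_{\max}}P_\ell(k)\mathcal{F}_Nv(k)e^{ikx}$, $P_\ell(k)\in\mathbb{C}^{d_v\times d_v}$, and real bias $b_\ell(x)=\sum_{|k|\le k_{\max}}\hat b_\ell(k)e^{ikx}$; $Q$ is a linear map applied pointwise. Output functions are defined for all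 $x\in\mathbb{T}$. The depth is $L$ and the size is the total number of tunable parameters. *)

(* Defs.v *)
From HB Require Import structures.
From mathcomp Require Import all_boot all_order all_algebra.
From mathcomp Require Import all_classical all_reals all_analysis.
Set Implicit Arguments. Unset Strict Implicit. Unset Printing Implicit Defensive.
Import Order.TTheory GRing.Theory Num.Theory.
Import numFieldNormedType.Exports.
Local Open Scope classical_set_scope.
Local Open Scope ring_scope.

Section FNODefs.
Variable R : realType.

Definition relu (x : R) : R := Num.max x 0.
Definition reluv (n : nat) (v : 'cV[R]_n) : 'cV[R]_n := map_mx relu v.

(* canonical representative in [0, 2pi) of a point of T = R / 2 pi Z *)
Definition tmod (x : R) : R := x - 2 * pi * (Num.floor (x / (2 * pi)))%:~R.

Definition periodize (A : set R) : set R :=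
  [set x | exists n : int, A (x - 2 * pi * n%:~R)].

Definition ubar (h w xi : R) : R -> R :=
  fun x => h * \1_(periodize [set y | `|y - xi| <= w / 2]) x.

Definition Gadv (a T : R) (u : R -> R) : R -> R := fun x => u (x - a * T).

(* A ReLU Fourier neural operator (parameters). Complex Fourier multipliers
   P_l(k) and complex bias coefficients bhat_l(k) are stored by real and
   imaginary parts; k ranges over -kmax..kmax, encoded by j : nat with
   k = j - kmax, 0 <= j < 2 kmax + 1.  Only layers l < L are used. *)
Record FNO := mkFNO {
  fno_N : nat;
  fno_dv : nat;
  fno_kmax : nat;
  fno_L : nat;
  fno_m : nat;
  fno_A1 : 'M[R]_(fno_m, 1 + 1);
  fno_c1 : 'cV[R]_fno_m;
  fno_A2 : 'M[R]_(fno_dv, fno_m);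
  fno_c2 : 'cV[R]_fno_dv;
  fno_W : nat -> 'M[R]_fno_dv;
  fno_Pre : nat -> nat -> 'M[R]_fno_dv;
  fno_Pim : nat -> nat -> 'M[R]_fno_dv;
  fno_bre : nat -> nat -> 'cV[R]_fno_dv;
  fno_bim : nat -> nat -> 'cV[R]_fno_dv;
  fno_Q : 'rV[R]_fno_dv }.

Variable F : FNO.
Local Notation dv := (fno_dv F).
Local Notation N := (fno_N F).
Local Notation kmax := (fno_kmax F).

Definition kval (j : nat) : R := (j%:Z - kmax%:Z)%:~R.

(* grid points x_j = 2 pi j / N, j = 1..N *)
Definition gridpt (j : nat) : R := 2 * pi * j%:R / N%:R.

(* real and imaginary parts of F_N v(k) = 1/N sum_j v(x_j) e^{-i k x_j} *)
Definition FN_re (v : R -> 'cV[R]_dv) (k : R) : 'cV[R]_dv :=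
  N%:R^-1 *: \sum_(1 <= j < N.+1) (cos (k * gridpt j) *: v (gridpt j)).
Definition FN_im (v : R -> 'cV[R]_dv) (k : R) : 'cV[R]_dv :=
  - (N%:R^-1 *: \sum_(1 <= j < N.+1) (sin (k * gridpt j) *: v (gridpt j))).

(* real part of (K_l v)(x) = sum_{|k|<=kmax} P_l(k) F_N v(k) e^{ikx} *)
Definition Kop (l : nat) (v : R -> 'cV[R]_dv) (x : R) : 'cV[R]_dv :=
  \sum_(0 <= j < (2 * kmax).+1)
    let k := kval j in
    let Pr := fno_Pre F l j in let Pi := fno_Pim F l j in
    let Fr := FN_re v k in let Fi := FN_im v k in
    (cos (k * x) *: (Pr *m Fr - Pi *m Fi) - sin (k * x) *: (Pr *m Fi + Pi *m Fr)).

(* real bias b_l(x) = Re sum_{|k|<=kmax} bhat_l(k) e^{ikx} *)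
Definition biasf (l : nat) (x : R) : 'cV[R]_dv :=
  \sum_(0 <= j < (2 * kmax).+1)
    (cos (kval j * x) *: fno_bre F l j - sin (kval j * x) *: fno_bim F l j).

Definition layer (l : nat) (v : R -> 'cV[R]_dv) : R -> 'cV[R]_dv :=
  fun x => reluv (fno_W F l *m v x + biasf l x + Kop l v x).

Definition lift (u : R -> R) : R -> 'cV[R]_dv :=
  fun x => fno_A2 F *m reluv (fno_A1 F *m col_mx (u x)%:M (tmod x)%:M + fno_c1 F)
           + fno_c2 F.

Fixpoint layers (n : nat) (u : R -> R) : R -> 'cV[R]_dv :=
  match n with
  | 0 => lift u
  | n'.+1 => layer n' (layers n' u)
  end.

Definition fno_eval (u : R -> R) : R -> R :=
  fun x => (fno_Q F *m layers (fno_L F) u x) 0 0.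

(* total number of real tunable parameters (complex parameters count twice) *)
Definition fno_size : nat :=
  (fno_m F * 2 + fno_m F + dv * fno_m F + dv
   + fno_L F * (dv * dv + 2 * (2 * kmax).+1 * (dv * dv) + 2 * (2 * kmax).+1 * dv)
   + dv)%N.

End FNODefs.

Definition L1dist (R : realType) (f g : R -> R) : \bar R :=
  (\int[@lebesgue_measure R]_(x in `[0%R, (2 * pi)%R]) (`|f x - g x|)%:E)%E.

(* expectation of f(X) for X ~ Unif[lo, hi] (Dirac mass if lo = hi) *)
Definition unif_mean (R : realType) (lo hi : R) (f : R -> \bar R) : \bar R :=
  if lo < hi then (((hi - lo)^-1)%:E * \int[@lebesgue_measure R]_(x in `[lo, hi]%classic) f x)%E
  else f lo.

(* E_{ubar ~ mu} || G_adv(ubar) - N(ubar) ||_{L^1(T)} with h, w, xi independent *)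
Definition adv_error (R : realType) (hl hh wl wh a T : R) (F : FNO R) : \bar R :=
  unif_mean hl hh (fun h =>
  unif_mean wl wh (fun w =>
  unif_mean 0 (2 * pi) (fun xi =>
    L1dist (Gadv a T (ubar h w xi)) (fno_eval F (ubar h w xi))))).

(* Main.v *)
Require Import Defs.
From HB Require Import structures.
From mathcomp Require Import all_boot all_order all_algebra.
From mathcomp Require Import all_classical all_reals all_analysis.
From mathcomp Require Import measurable_realfun ring lra zify.
Import Order.TTheory GRing.Theory Num.Theory.
Import numFieldNormedType.Exports.
Local Open Scope ring_scope.
Set Implicit Arguments.
Unset Strict Implicit.

(** Write d = 2 pi / N and let p d, ..., (p + M - 1) d be the grid points in the
    support of u. A network of fixed depth and width recovers everything about
    this discrete window exactly, because the size of the weights is not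
    restricted. As u takes its values in {0} or [hl, hh], its indicator chi is a
    ReLU function of u; mode 0 gives M, the sum of chi over the grid. Mode 1
    applied to chi gives the sum of cos (y - (p + i) d), which is
    sin (M d / 2) / sin (d / 2) cos (y - c), c being the centre of the window.
    The level of this function that cuts out the window is the sum of
    cos ((i + 1/2) d) for i < M; it is a mode 0 sum over the grid points x with
    tmod x / d < M. A steep ramp applied to the difference is therefore equal to
    the indicator of the window, up to the two grid cells at its end points.
    Phases of the mode 1 multiplier translate it: translated by a T it is the
    support of the output, while translated by d and compared with chi it singles
    out the first grid point of the window, where u takes the value h, so that a
    mode 0 sum returns h. The error is at most hh on two cells of length d of the
    circle, hence O(1 / N) uniformly in h, w and xi. *)

(** * Periodicity, sums over the grid and the box profile *)

Section PeriodicGrid.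
Variable R : realType.
Implicit Types (f : R -> R) (x y : R) (n s : int).

Lemma periodic_addZ f : (forall x, f (x + 2 * pi) = f x) ->
  forall n x, f (x + 2 * pi * n%:~R) = f x.
Proof.
move=> fP; elim/int_ind => [|n IH|n IH] x.
- by rewrite mulr0 addr0.
- rewrite (_ : x + _ = x + 2 * pi * n%:~R + 2 * pi) ?fP ?IH //.
  by rewrite intS intrD; ring.
- rewrite -fP -[RHS]IH; congr f.
  by rewrite intS opprD intrD intrN; ring.
Qed.

Lemma cosD2piZ x n : cos (x + 2 * pi * n%:~R) = cos x.
Proof.
by apply: periodic_addZ => y; rewrite mulr_natl cosD2pi.
Qed.

Lemma sum_shift_periodic (N : nat) (g : int -> R) :
  (forall k, g (k + N%:Z) = g k) ->
  forall s, \sum_(i < N) g (s + i%:Z) = \sum_(i < N) g i%:Z.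
Proof.
case: N => [|N] gP s; first by rewrite !big_ord0.
have shift1 t : \sum_(i < N.+1) g (t + 1 + i%:Z) = \sum_(i < N.+1) g (t + i%:Z).
  rewrite big_ord_recr [RHS]big_ord_recl /= addrC; congr (_ + _).
    by rewrite -(gP (t + 0%:Z)); congr g; lia.
  by apply: eq_bigr => i _; congr g; rewrite /bump /=; lia.
elim/int_ind: s => [|n IH|n IH].
- by apply: eq_bigr => i _; rewrite add0r.
- by rewrite intS [1 + _]addrC shift1.
- rewrite -IH -shift1; apply: eq_bigr => i _; congr g; lia.
Qed.

(** Frees the starting point of a grid sum: started at [p], the window takes the indices [0] to
    [M - 1]. *)
Lemma sum_grid_shift (N : nat) f s : (0 < N)%N ->
  (forall x, f (x + 2 * pi) = f x) ->
  \sum_(1 <= j < N.+1) f (2 * pi * j%:R / N%:R) =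
  \sum_(i < N) f ((s + i%:Z)%:~R * (2 * pi / N%:R)).
Proof.
move=> N0 fP; have N0' : (N%:R : R) != 0 by rewrite pnatr_eq0; lia.
pose g (k : int) := f (k%:~R * (2 * pi / N%:R)).
have gP k : g (k + N%:Z) = g k.
  by rewrite /g -[RHS]fP; congr f; rewrite intrD -pmulrn; field.
(* The shift [1] matches the grid, whose indices start at [1]. *)
rewrite (sum_shift_periodic gP s) -(sum_shift_periodic gP 1).
rewrite big_add1 big_mkord /=; apply: eq_bigr => i _; rewrite /g; congr f.
by rewrite intrD -pmulrn -natr1; field.
Qed.

Lemma tmodD2pi x : tmod (x + 2 * pi) = tmod x.
Proof.
have p0 : (pi : R) != 0 by rewrite gt_eqF ?pi_gt0.
rewrite /tmod (_ : (x + 2 * pi) / (2 * pi) = x / (2 * pi) + 1%:~R); last first.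
  by move: (pi : R) p0 => P P0; field.
rewrite Num.Theory.floorDrz ?num_real ?intr_int //.
by rewrite Num.Theory.intrKfloor intrD; ring.
Qed.

Lemma tmod_id x : 0 <= x < 2 * pi -> tmod x = x.
Proof.
move=> /andP[x0 x1]; have p0 := pi_gt0 R.
rewrite /tmod (@Num.Theory.floor_def _ _ 0) ?mulr0 ?subr0 //.
by rewrite add0r divr_ge0 ?ltr_pdivrMr //=; lra.
Qed.

Lemma tmod_ge0 x : 0 <= tmod x.
Proof.
have p0 := pi_gt0 R; rewrite /tmod subr_ge0.
rewrite mulrC -ler_pdivlMr; last by lra.
exact: Num.Theory.floor_le.
Qed.

Lemma ubarD2piZ (h w xi : R) x n : ubar h w xi (x + 2 * pi * n%:~R) = ubar h w xi x.
Proof.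
rewrite /ubar; congr (_ * _); rewrite !indicE; congr ((_ : bool)%:R).
apply/idP/idP; rewrite !inE /periodize /= => -[m Hm].
  exists (m - n); rewrite (_ : x - _ = x + 2 * pi * n%:~R - 2 * pi * m%:~R) //.
  by rewrite intrB; ring.
exists (m + n); rewrite (_ : x + _ - _ = x - 2 * pi * m%:~R) //.
by rewrite intrD; ring.
Qed.

Lemma ubarD2pi (h w xi : R) x : ubar h w xi (x + 2 * pi) = ubar h w xi x.
Proof. by rewrite -(ubarD2piZ h w xi x 1) mulr1. Qed.

Lemma ubar_cases (h w xi x : R) : ubar h w xi x = h \/ ubar h w xi x = 0.
Proof.
by rewrite /ubar indicE; case: (_ \in _); rewrite ?mulr1 ?mulr0; [left|right].
Qed.

Lemma ubar_on (h w xi x : R) : xi - w / 2 <= x <= xi + w / 2 -> ubar h w xi x = h.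
Proof.
move=> /andP[x1 x2]; rewrite /ubar indicE mem_set ?mulr1 //.
by exists 0 => /=; rewrite mulr0 subr0 ler_norml; lra.
Qed.

Lemma ubar_off (h w xi x : R) : xi + w / 2 < x < xi - w / 2 + 2 * pi ->
  ubar h w xi x = 0.
Proof.
move=> /andP[x1 x2]; rewrite /ubar indicE memNset ?mulr0 //.
move=> -[n] /=; rewrite ler_norml => /andP[]; have p0 := pi_gt0 R.
(* Copies of the box with [n <= 0] end before [x]; those with [n >= 1] start after it. *)
case: (lerP n 0) => n0; move=> y1 y2.
  have : 2 * pi * n%:~R <= 0 :> R.
    by rewrite pmulr_rle0 ?lerz0 //; lra.
  lra.
have : 2 * pi * 1 <= 2 * pi * n%:~R :> R.
  by rewrite ler_wpM2l ?ler1z //; lra.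
lra.
Qed.

End PeriodicGrid.

(** * The trigonometric function that cuts out a window *)

Section Threshold.
Variable R : realType.
Implicit Types (d y : R) (p n : int) (M : nat).

(** Telescopes, as [2 sin (d / 2) cos t = sin (t + d / 2) - sin (t - d / 2)]. *)
Lemma sum_cos_progression d (b : R) M :
  2 * sin (d / 2) * \sum_(i < M) cos (b + i%:R * d) =
  sin (b + M%:R * d - d / 2) - sin (b - d / 2).
Proof.
elim: M => [|M IH]; first by rewrite big_ord0 mulr0 mul0r addr0 subrr.
rewrite big_ord_recr /= mulrDr IH.
set t := b + M%:R * d.
rewrite (_ : b + M.+1%:R * d - d / 2 = t + d / 2); last by rewrite /t -natr1; field.
rewrite (sinD t (d / 2)) (sinB t (d / 2)); ring.
Qed.

(* A positive multiple of cos (y - c) - cos (M d / 2), where c is the midpoint of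
   the M consecutive grid points p d, ..., (p + M - 1) d (see [thresholdE]); the
   sums are written in the form in which a Fourier layer can compute them. *)
Definition threshold d p M y : R :=
  \sum_(i < M) cos (y - (p + i%:Z)%:~R * d) - \sum_(i < M) cos (i%:R * d + d / 2).

(** Both sums are progressions of step [d]; the second yields [sin (M d)], which splits as
    [2 sin (M d / 2) cos (M d / 2)]. *)
Lemma thresholdE d p M y :
  sin (d / 2) * threshold d p M y =
  sin (M%:R * d / 2) *
    (cos (y - (p%:~R + (M%:R - 1) / 2) * d) - cos (M%:R * d / 2)).
Proof.
have -> : threshold d p M y = \sum_(i < M) cos (p%:~R * d - y + i%:R * d)
    - \sum_(i < M) cos (d / 2 + i%:R * d).
  congr (_ - _); apply: eq_bigr => i _; last by rewrite addrC.
  by rewrite -cosN; congr cos; rewrite intrD -pmulrn; ring.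
apply: (@mulfI _ 2); first by rewrite pnatr_eq0.
rewrite mulrA mulrBr !sum_cos_progression subrr sin0 subr0.
set z := y - _; set b := M%:R * d / 2.
rewrite (_ : p%:~R * d - y + _ - _ = b - z); last by rewrite /b /z; field.
rewrite (_ : p%:~R * d - y - _ = - (b + z)); last by rewrite /b /z; field.
rewrite (_ : d / 2 + M%:R * d - d / 2 = b + b); last by rewrite /b; field.
by clearbody z b; rewrite sinN !sinD sinN cosN; ring.
Qed.

Lemma ler_cos_norm (z b : R) : `|z| <= b -> b <= pi -> cos b <= cos z.
Proof.
move=> zb bp; have z0 := normr_ge0 z.
rewrite -(cos_norm z) leNgt ltr_cos -?leNgt // in_itv /=; lra.
Qed.

Lemma ltr_cos_lt (z b : R) : 0 <= z -> z < b -> b <= pi -> cos b < cos z.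
Proof.
by move=> z0 zb bp; rewrite ltr_cos // in_itv /= ?z0 ?bp ?andbT //=; lra.
Qed.

Variable N : nat.
Let d : R := 2 * pi / N%:R.

(* the minimum of [threshold d p M] between the first and the last grid point
   of the window *)
Definition gap M : R :=
  sin (M%:R * d / 2) / sin (d / 2) * (cos ((M%:R - 1) * d / 2) - cos (M%:R * d / 2)).

(** One steepness has to serve every [M]: the sum dominates each [(gap M)^-1] with [0 < M < N]. The
    term [M = 0] is [0^-1 = 0]. *)
Definition slope : R := \sum_(M < N) (gap M)^-1.

Lemma grid_angle M : (M <= N)%N -> (0 < N)%N -> M%:R * d / 2 <= pi.
Proof.
move=> MN N0; have p0 := pi_gt0 R.
have N0' : (0 : R) < N%:R by rewrite ltr0n.
rewrite (_ : _ / 2 = pi * (M%:R / N%:R)); last by rewrite /d; field; lra.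
by rewrite ger_pMr // ler_pdivrMr // mul1r ler_nat.
Qed.

Lemma sin_grid_gt0 M : (0 < M < N)%N -> 0 < sin (M%:R * d / 2).
Proof.
move=> /andP[M0 MN]; have p0 := pi_gt0 R.
have N0 : (0 : R) < N%:R by rewrite ltr0n; lia.
have d0 : 0 < d by rewrite /d divr_gt0 //; lra.
have Md : 0 < M%:R * d by rewrite mulr_gt0 // ltr0n.
have := @grid_angle M.+1 MN (leq_ltn_trans (leq0n _) MN).
by rewrite -natr1 => Mpi; apply: sin_gt0_pi; lra.
Qed.

Lemma gap_gt0 M : (0 < M < N)%N -> 0 < gap M.
Proof.
move=> MN; have /andP[M0 MltN] := MN; have p0 := pi_gt0 R.
have N0 : (0 : R) < N%:R by rewrite ltr0n; lia.
have d0 : 0 < d by rewrite /d divr_gt0 //; lra.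
have M1 : (1 : R) <= M%:R by rewrite ler1n.
have s1 : 0 < sin (d / 2) by have := @sin_grid_gt0 1; rewrite mul1r; apply; lia.
rewrite /gap mulr_gt0 ?divr_gt0 ?sin_grid_gt0 // subr_gt0; apply: ltr_cos_lt.
- by rewrite divr_ge0 // mulr_ge0 ?subr_ge0 // ltW.
- by lra.
- by apply: grid_angle; lia.
Qed.

Lemma slope_gap M : (0 < M < N)%N -> 1 <= slope * gap M.
Proof.
move=> MN; have g0 := gap_gt0 MN; have /andP[M0 MltN] := MN.
rewrite -ler_pdivrMr // div1r /slope (bigD1 (Ordinal MltN)) //= lerDl.
apply: sumr_ge0 => -[[|i] Hi] _ /=; last by rewrite invr_ge0 ltW // gap_gt0.
by rewrite /gap !mul0r sin0 !mul0r invr0.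
Qed.

Lemma slope_ge0 : 0 <= slope.
Proof.
apply: sumr_ge0 => -[[|i] Hi] _ /=; last by rewrite invr_ge0 ltW // gap_gt0.
by rewrite /gap !mul0r sin0 !mul0r invr0.
Qed.

Lemma thresholdD2piZ p M y n : threshold d p M (y + 2 * pi * n%:~R) = threshold d p M y.
Proof.
congr (_ - _); apply: eq_bigr => i _; rewrite -[RHS](cosD2piZ _ n).
by congr cos; ring.
Qed.

Lemma threshold_on p M y : (0 < M < N)%N ->
  p%:~R * d <= y <= (p%:~R + M%:R - 1) * d -> 1 <= slope * threshold d p M y.
Proof.
move=> MN /andP[y1 y2]; have /andP[M0 MltN] := MN; have p0 := pi_gt0 R.
have N0 : (0 : R) < N%:R by rewrite ltr0n; lia.
have d0 : 0 < d by rewrite /d divr_gt0 //; lra.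
have s1 : 0 < sin (d / 2) by have := @sin_grid_gt0 1; rewrite mul1r; apply; lia.
apply: (le_trans (slope_gap MN)); rewrite ler_wpM2l ?slope_ge0 //.
rewrite -(ler_pM2l s1) thresholdE /gap [leLHS]mulrA [sin (d / 2) * _]mulrC.
rewrite divfK ?gt_eqF //.
rewrite ler_wpM2l ?(ltW (sin_grid_gt0 MN)) // lerD2r; apply: ler_cos_norm.
  by rewrite ler_norml; nra.
have := @grid_angle M (ltnW MltN) (ltn_trans M0 MltN); lra.
Qed.

Lemma threshold_off p M y : (0 < M < N)%N ->
  (p%:~R + M%:R) * d <= y <= (p%:~R + N%:R - 1) * d -> threshold d p M y <= 0.
Proof.
move=> MN /andP[y1 y2]; have /andP[M0 MltN] := MN; have p0 := pi_gt0 R.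
have N0 : (0 : R) < N%:R by rewrite ltr0n; lia.
have d0 : 0 < d by rewrite /d divr_gt0 //; lra.
have Nd : N%:R * d = 2 * pi by rewrite /d; field; lra.
have s1 : 0 < sin (d / 2) by have := @sin_grid_gt0 1; rewrite mul1r; apply; lia.
rewrite -(ler_pM2l s1) thresholdE mulr0 pmulr_rle0 ?sin_grid_gt0 // subr_le0.
set z := _ - _; set b := _ / 2.
(* The range of [z] surrounds [pi]; subtracting [pi] leaves at most [pi - b] in absolute value,
   where [ler_cos_norm] applies. *)
have cosBpi (t : R) : cos t = - cos (t - pi) by rewrite cosB cospi sinpi; ring.
rewrite (cosBpi z) (cosBpi b) lerN2 -[cos (b - pi)]cosN opprB; apply: ler_cos_norm; rewrite /z /b.
  by rewrite ler_norml; nra.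
have : 0 <= M%:R * d by rewrite mulr_ge0 ?ler0n // ltW.
lra.
Qed.

End Threshold.

(** * Upper bounds for integrals and uniform means *)

Section Integration.
Variable R : realType.
Local Notation mu := (@lebesgue_measure R).

(* No measurability is required: the integral of a nonnegative function is
   a supremum over the simple functions below it. *)
Lemma le_integral_nonneg (D : set R) (f g : R -> \bar R) :
  (forall x, D x -> 0 <= f x)%E -> (forall x, D x -> f x <= g x)%E ->
  (\int[mu]_(x in D) f x <= \int[mu]_(x in D) g x)%E.
Proof.
move=> f0 fg; have g0 x : D x -> (0 <= g x)%E.
  by move=> Dx; apply: le_trans (f0 _ Dx) (fg _ Dx).
rewrite ge0_integralE // ge0_integralE //.
apply: ub_ereal_sup => _ [s /= sf <-]; apply: ereal_sup_ubound; exists s => //= x.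
apply: le_trans (sf x) _; rewrite !patchE; case: ifPn => // /set_mem; exact: fg.
Qed.

Lemma unif_mean_le (lo hi c : R) (f : R -> \bar R) : lo <= hi ->
  (forall x, lo <= x <= hi -> (0 <= f x)%E) ->
  (forall x, lo <= x <= hi -> (f x <= c%:E)%E) -> (0 <= unif_mean lo hi f <= c%:E)%E.
Proof.
move=> lh f0 fc; rewrite /unif_mean; case: ltP => [lth|hl]; last first.
  by rewrite f0 ?fc ?lexx ?lh.
have I0 : (0 <= (hi - lo)^-1)%R by rewrite invr_ge0 subr_ge0.
apply/andP; split.
  rewrite mule_ge0 ?lee_fin //; apply: integral_ge0 => x /=.
  by rewrite in_itv /=; exact: f0.
apply: (@le_trans _ _ (((hi - lo)^-1)%:E * \int[mu]_(x in `[lo, hi]%classic) cst c%:E x)%E).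
  apply: lee_wpmul2l; first by rewrite lee_fin.
  apply: le_integral_nonneg => x /=; rewrite in_itv /=; [exact: f0|exact: fc].
rewrite integral_cst //= lebesgue_measure_itv /= lte_fin lth -EFinB -!EFinM lee_fin.
by rewrite mulrCA mulVf ?mulr1 // subr_eq0 gt_eqF.
Qed.

(** [f] lies below [K] times the indicator of the union of the intervals, and subadditivity allows
    them to overlap. *)
Lemma integral_le_four_itv (D : set R) (f : R -> R) (K d : R) (c : nat -> R) :
  measurable D -> 0 <= K -> 0 <= d ->
  (forall x, D x -> 0 <= f x) -> (forall x, D x -> f x <= K) ->
  (forall x, D x -> f x = 0 \/ exists2 i, (i < 4)%N & c i <= x <= c i + d) ->
  (\int[mu]_(x in D) (f x)%:E <= (K * (4 * d))%:E)%E.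
Proof.
move=> mD K0 d0 f0 fK fS.
pose I i : set R := `[c i, c i + d]%classic.
have mI i : measurable (I i) by exact: measurable_itv.
have muI i : (mu (I i) = d%:E)%E.
  rewrite /I lebesgue_measure_itv /= lte_fin.
  case: ltP => [_|]; first by rewrite -EFinB; congr EFin; ring.
  by move=> h; congr EFin; lra.
pose S : set R := \big[setU/set0]_(i < 4) I i.
have mS : measurable S by apply: bigsetU_measurable.
apply: (@le_trans _ _ (\int[mu]_(x in D) (K%:E * (\1_S x)%:E))%E).
  apply: le_integral_nonneg => x Dx; first by rewrite lee_fin f0.
  rewrite -EFinM lee_fin; case: (fS x Dx) => [->|[i i4 ci]].
    by rewrite mulr_ge0.
  rewrite indicE mem_set ?mulr1 ?fK // /S -(bigcup_mkord 4 I).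
  by exists i => //=; rewrite /I /= in_itv.
rewrite ge0_integralZl_EFin //; last first.
  by apply/measurable_EFinP; apply: measurable_indic.
rewrite integral_indic // EFinM; apply: lee_wpmul2l; first by rewrite lee_fin.
apply: (@le_trans _ _ (mu S)).
  by apply: le_measure; rewrite ?inE; [exact: measurableI|exact: mS|exact: subIsetl].
apply: (@le_trans _ _ (\sum_(i < 4) mu (I i))%E).
  apply: (@content_subadditive _ _ _ mu S I 4) => //.
  by move=> k _; exact: mI.
under eq_bigr do rewrite muI.
by rewrite sumEFin lee_fin sumr_const card_ord mulr_natl.
Qed.

End Integration.

(** * ReLU and the ramp built from it *)

Section Relu.
Variable R : realType.
Implicit Types x y : R.

Lemma relu_id x : 0 <= x -> relu x = x.
Proof. by move=> x0; rewrite /relu max_l. Qed.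

Lemma relu_0 x : x <= 0 -> relu x = 0.
Proof. by move=> x0; rewrite /relu max_r. Qed.

(** A difference of two ReLUs: two channels of one layer hold them and the next layer subtracts. *)
Definition clamp y : R := relu y - relu (y - 1).

Lemma clamp_1 y : 1 <= y -> clamp y = 1.
Proof. by move=> y1; rewrite /clamp !relu_id; lra. Qed.

Lemma clamp_0 y : y <= 0 -> clamp y = 0.
Proof. by move=> y1; rewrite /clamp !relu_0; lra. Qed.

Lemma clamp_itv y : 0 <= clamp y <= 1.
Proof.
case: (lerP y 0) => [/clamp_0 ->|y0]; first by rewrite lexx ler01.
case: (lerP 1 y) => [/clamp_1 ->|y1]; first by rewrite lexx ler01.
by rewrite /clamp relu_id ?relu_0; lra.
Qed.

End Relu.

Lemma sum_ord_support (R : realType) (n k : nat) (f g : nat -> R) : (k <= n)%N ->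
  (forall i, (i < k)%N -> f i = g i) -> (forall i, (k <= i < n)%N -> f i = 0) ->
  \sum_(i < n) f i = \sum_(i < k) g i.
Proof.
move=> kn fg f0; rewrite [RHS](big_ord_widen n g kn) [RHS]big_mkcond /=.
by apply: eq_bigr => i _; case: ltnP => ik; [exact: fg|rewrite f0 ?ik //=].
Qed.

Lemma layersS (R : realType) (F : FNO R) n v : layers F n.+1 v = layer (F := F) n (layers F n v).
Proof. by []. Qed.

(** * Real form of Fourier layers with cut-off 1 *)

Section OneMode.
Variable R : realType.
Variables (N n L m : nat).
Variables (A1 : 'M[R]_(m, 1 + 1)) (c1 : 'cV[R]_m) (A2 : 'M[R]_(n, m)) (c2 : 'cV[R]_n).
Variables (W P0 P1 P1' : nat -> 'M[R]_n) (b0 b1 b1' : nat -> 'cV[R]_n) (Q : 'rV[R]_n).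

(* The kernel is Re (P0 F(0) + (P1 + i P1') F(1) e^{ix}), multiplied by N to
   turn the normalised discrete Fourier transform F into a plain sum; index j
   stands for the mode j - 1 and the mode -1 is not used. *)
Definition one_mode_fno : FNO R :=
  @mkFNO R N n 1 L m A1 c1 A2 c2 W
    (fun l j => if j is j'.+1 then N%:R *: (if j' is 0 then P0 l else P1 l) else 0)
    (fun l j => if j is 2 then N%:R *: P1' l else 0)
    (fun l j => if j is j'.+1 then (if j' is 0 then b0 l else b1 l) else 0)
    (fun l j => if j is 2 then b1' l else 0) Q.

Lemma one_mode_liftE (u : R -> R) x :
  @Defs.lift R one_mode_fno u x = A2 *m reluv (A1 *m col_mx (u x)%:M (tmod x)%:M + c1) + c2.
Proof. by []. Qed.

(** By the addition formulas, mode 1 acts as a convolution on the grid with cosine and sine. *)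
Lemma one_mode_layerE (v : R -> 'cV[R]_n) l x i : (0 < N)%N ->
  layer (F := one_mode_fno) l v x i 0 =
  relu (\sum_k W l i k * v x k 0
        + (b0 l i 0 + cos x * b1 l i 0 - sin x * b1' l i 0)
        + \sum_k P0 l i k * \sum_(1 <= j < N.+1) v (2 * pi * j%:R / N%:R) k 0
        + \sum_k (P1 l i k * \sum_(1 <= j < N.+1)
             cos (x - 2 * pi * j%:R / N%:R) * v (2 * pi * j%:R / N%:R) k 0
           - P1' l i k * \sum_(1 <= j < N.+1)
             sin (x - 2 * pi * j%:R / N%:R) * v (2 * pi * j%:R / N%:R) k 0)).
Proof.
move=> N0; have N0' : (N%:R : R) != 0 by rewrite pnatr_eq0; lia.
rewrite /layer /reluv mxE; congr relu.
rewrite /biasf /Kop /kval /=.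
have sum3 (f : nat -> 'cV[R]_n) : \sum_(0 <= j < (2 * 1).+1) f j = f 0%N + f 1%N + f 2%N.
  by rewrite !big_nat_recr ?big_geq //= add0r.
rewrite !sum3 /= !subrr !mulr0z !mul0r cos0 sin0.
have -> : ((2%:Z - 1%:Z)%:~R : R) = 1 by [].
rewrite !scaler0 !mul0mx !subr0 !addr0 !scaler0 !subr0 !add0r !scale1r !scale0r !subr0 !mul1r.
pose g (j : nat) : R := 2 * pi * j%:R / N%:R.
have FRk (k : R) e : FN_re (F := one_mode_fno) v k e 0 =
    N%:R^-1 * \sum_(1 <= j < N.+1) cos (k * g j) * v (g j) e 0.
  rewrite /FN_re mxE summxE; congr (_ * _); apply: eq_bigr => j _.
  by rewrite mxE.
have FIk (k : R) e : FN_im (F := one_mode_fno) v k e 0 =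
    - (N%:R^-1 * \sum_(1 <= j < N.+1) sin (k * g j) * v (g j) e 0).
  rewrite /FN_im !mxE summxE; congr (- (_ * _)); apply: eq_bigr => j _.
  by rewrite mxE.
rewrite !mxE -[RHS]addrA; congr (_ + _); first by rewrite !addrA.
have -> : \sum_e (N%:R *: P0 l) i e * FN_re (F := one_mode_fno) v 0 e 0 =
    \sum_e P0 l i e * \sum_(1 <= j < N.+1) v (g j) e 0.
  apply: eq_bigr => e _; rewrite FRk mxE mulrACA mulfV // mul1r; congr (_ * _).
  by apply: eq_bigr => j _; rewrite mul0r cos0 mul1r.
congr (_ + _).
have sumcos e : \sum_(1 <= j < N.+1) cos (x - g j) * v (g j) e 0 =
    cos x * (\sum_(1 <= j < N.+1) cos (g j) * v (g j) e 0)
    + sin x * (\sum_(1 <= j < N.+1) sin (g j) * v (g j) e 0).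
  by rewrite !mulr_sumr -big_split /=; apply: eq_bigr => j _; rewrite cosB; ring.
have sumsin e : \sum_(1 <= j < N.+1) sin (x - g j) * v (g j) e 0 =
    sin x * (\sum_(1 <= j < N.+1) cos (g j) * v (g j) e 0)
    - cos x * (\sum_(1 <= j < N.+1) sin (g j) * v (g j) e 0).
  by rewrite !mulr_sumr -sumrB /=; apply: eq_bigr => j _; rewrite sinB; ring.
rewrite -sumrB -big_split /= !mulr_sumr -sumrB; apply: eq_bigr => e _.
have FR1 : FN_re (F := one_mode_fno) v 1 e 0 =
    N%:R^-1 * \sum_(1 <= j < N.+1) cos (g j) * v (g j) e 0.
  by rewrite FRk; congr (_ * _); apply: eq_bigr => j _; rewrite mul1r.
have FI1 : FN_im (F := one_mode_fno) v 1 e 0 =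
    - (N%:R^-1 * \sum_(1 <= j < N.+1) sin (g j) * v (g j) e 0).
  by rewrite FIk; congr (- (_ * _)); apply: eq_bigr => j _; rewrite mul1r.
rewrite !FR1 !FI1 !mxE -/(g _) sumcos sumsin.
set C := \sum_(1 <= j < N.+1) cos _ * _; set S := \sum_(1 <= j < N.+1) sin _ * _.
by clearbody C S; field.
Qed.

End OneMode.

(** * The network and its evaluation layer by layer *)

Section AdvectionNetwork.
Variable R : realType.
Variables (N : nat) (hl hh aT : R).
Hypothesis N0 : (0 < N)%N.
Hypothesis hl0 : 0 < hl.
Let d : R := 2 * pi / N%:R.
Let lam : R := slope R N.

Definition seq_cV (n : nat) (s : seq R) : 'cV[R]_n := \col_i s`_i.
Definition seq_mx (n m : nat) (s : seq (seq R)) : 'M[R]_(n, m) :=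
  \matrix_(i, j) (nth [::] s i)`_j.

(* The entries omitted from the tables below are 0. With u the input, chi its
   indicator, t = tmod x / d and M the number of grid points in the window, the
   channels are
     lifting : u, chi, t
     layer 1 : u, chi, relu (t + 1 - M), M
     layer 2 : u, chi, relu (cos (x + d / 2) + 1 - 2 relu (t + 1 - M)), M
     layer 3 : u, and the two summands of clamp (lam * threshold (x - s)), first
               for s = d and then for s = aT
     layer 4 : h at the first grid point of the window and 0 at the other ones,
               and the translated indicator
     layer 5 : the output. *)
Definition adv_W : seq (seq (seq R)) :=
  [:: [:: [:: 1]; [:: 0; 1]; [:: 0; 0; 1]];
      [:: [:: 1]; [:: 0; 1]; [:: 0; 0; -2]; [:: 0; 0; 0; 1]];
      [:: [:: 1]; [:: 0; 0; 0; lam]; [:: 0; 0; 0; lam]; [:: 0; 0; 0; lam];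
          [:: 0; 0; 0; lam]];
      [:: [:: 1; - hh; hh]; [:: 0; 0; 0; 1; -1]];
      [:: [:: 0; hh]]].

Definition adv_P0 : seq (seq (seq R)) :=
  [:: [:: [::]; [::]; [:: 0; -1]; [:: 0; 1]];
      [::];
      [:: [::]; [:: 0; 0; - lam]; [:: 0; 0; - lam]; [:: 0; 0; - lam]; [:: 0; 0; - lam]];
      [::];
      [:: [:: 1]]].

Definition adv_P1 : seq (seq (seq R)) :=
  [:: [::]; [::];
      [:: [::]; [:: 0; lam * cos d]; [:: 0; lam * cos d];
          [:: 0; lam * cos aT]; [:: 0; lam * cos aT]]].

Definition adv_P1' : seq (seq (seq R)) :=
  [:: [::]; [::];
      [:: [::]; [:: 0; - (lam * sin d)]; [:: 0; - (lam * sin d)];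
          [:: 0; - (lam * sin aT)]; [:: 0; - (lam * sin aT)]]].

Definition adv_b0 : seq (seq R) :=
  [:: [:: 0; 0; 1]; [:: 0; 0; 1]; [:: 0; 0; -1; 0; -1]; [::]; [:: - hh]].

Definition adv_b1 : seq (seq R) := [:: [::]; [:: 0; 0; cos (d / 2)]].

Definition adv_b1' : seq (seq R) := [:: [::]; [:: 0; 0; sin (d / 2)]].

(** The hidden neurons of the lifting are [u], [u - hl] and [tmod x]; the argument [5] of
    [one_mode_fno] is the depth. *)
Definition adv_fno : FNO R :=
  one_mode_fno N 5
    (row_mx (seq_cV 3 [:: 1; 1; 0]) (seq_cV 3 [:: 0; 0; 1])) (seq_cV 3 [:: 0; - hl])
    (seq_mx 5 3 [:: [:: 1]; [:: hl^-1; - hl^-1]; [:: 0; 0; d^-1]]) 0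
    (fun l => seq_mx 5 5 (nth [::] adv_W l)) (fun l => seq_mx 5 5 (nth [::] adv_P0 l))
    (fun l => seq_mx 5 5 (nth [::] adv_P1 l)) (fun l => seq_mx 5 5 (nth [::] adv_P1' l))
    (fun l => seq_cV 5 (nth [::] adv_b0 l)) (fun l => seq_cV 5 (nth [::] adv_b1 l))
    (fun l => seq_cV 5 (nth [::] adv_b1' l)) (seq_mx 1 5 [:: [:: 1]]).

Variables (u : R -> R).

Let gsum (f : R -> R) : R := \sum_(1 <= j < N.+1) f (2 * pi * j%:R / N%:R).

(** Equals [1] where [u = h >= hl], since the difference is then [h - (h - hl) = hl]. *)
Definition adv_ind x : R := (relu (u x) - relu (u x - hl)) / hl.

Lemma adv_lift x :
  layers adv_fno 0 u x = seq_cV 5 [:: relu (u x); adv_ind x; relu (tmod x) / d].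
Proof.
apply/colP => i; rewrite [layers _ _ _]/= one_mode_liftE mul_row_col !mul_mx_scalar.
rewrite !mxE !big_ord_recl big_ord0 !mxE /=.
case: i => [[|[|[|[|[|//]]]]] ?]; rewrite /= /adv_ind
  ?mul0r ?mul1r ?addr0 ?add0r ?mulr0 ?mulr1 ?addr0 ?add0r //.
- ring.
- by rewrite mulrC.
Qed.

Let dot (a b : seq R) : R := \sum_(k < 5) a`_k * b`_k.

Lemma dotE a b : dot a b = a`_0 * b`_0 + a`_1 * b`_1 + a`_2 * b`_2 + a`_3 * b`_3 + a`_4 * b`_4.
Proof. by rewrite /dot !big_ord_recl big_ord0 /= addr0 !addrA. Qed.

(** With states kept as lists, each layer is evaluated row by row from the tables. *)
Lemma adv_layerE l (s : R -> seq R) x i :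
  layer (F := adv_fno) l (fun y => seq_cV 5 (s y)) x i 0 =
  relu (dot (nth [::] (nth [::] adv_W l) i) (s x)
    + ((nth [::] adv_b0 l)`_i + cos x * (nth [::] adv_b1 l)`_i
       - sin x * (nth [::] adv_b1' l)`_i)
    + dot (nth [::] (nth [::] adv_P0 l) i) (mkseq (fun k => gsum (fun y => (s y)`_k)) 5)
    + (dot (nth [::] (nth [::] adv_P1 l) i)
         (mkseq (fun k => gsum (fun y => cos (x - y) * (s y)`_k)) 5)
       - dot (nth [::] (nth [::] adv_P1' l) i)
         (mkseq (fun k => gsum (fun y => sin (x - y) * (s y)`_k)) 5))).
Proof.
rewrite one_mode_layerE // sumrB !mxE; congr (relu (_ + _ + _ + (_ - _)));
  apply: eq_bigr => k _; rewrite ?nth_mkseq ?mxE //; congr (_ * _);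
  by apply: eq_bigr => j _; rewrite mxE.
Qed.

Lemma adv_layer1 x :
  layers adv_fno 1 u x =
  seq_cV 5 [:: relu (relu (u x)); relu (adv_ind x);
           relu (relu (tmod x) / d + 1 - gsum adv_ind); relu (gsum adv_ind); relu 0].
Proof.
apply/colP => i; rewrite layersS (funext adv_lift) adv_layerE mxE.
case: i => [[|[|[|[|[|//]]]]] ?] /=; congr relu;
  rewrite !dotE /=
  !(mul0r, mulr0, oppr0, addr0, add0r, subr0, mul1r) //.
by rewrite mulN1r.
Qed.

Variable h : R.
Hypothesis hh_ge : h <= hh.
Hypothesis hl_le : hl <= h.
Variables (p : int) (M : nat).
Hypothesis M_bound : (0 < M < N)%N.
Hypothesis uD2pi : forall x, u (x + 2 * pi) = u x.
Hypothesis u_values : forall x, u x = h \/ u x = 0.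
Hypothesis u_on : forall i, (i < M)%N -> u ((p + i%:Z)%:~R * d) = h.
Hypothesis u_off : forall i, (M <= i < N)%N -> u ((p + i%:Z)%:~R * d) = 0.

Let h_ge0 : 0 <= h. Proof. exact: le_trans (ltW hl0) hl_le. Qed.

Let u_ge0 x : 0 <= u x.
Proof. by case: (u_values x) => ->. Qed.

Let ind_on x : u x = h -> adv_ind x = 1.
Proof.
move=> e; rewrite /adv_ind e !relu_id ?subr_ge0 //.
by rewrite opprB addrC subrK divff // gt_eqF.
Qed.

Let ind_off x : u x = 0 -> adv_ind x = 0.
Proof.
by move=> e; rewrite /adv_ind e !relu_0 ?subrr ?mul0r // sub0r oppr_le0 ltW.
Qed.

Let ind_ge0 x : 0 <= adv_ind x.
Proof. by case: (u_values x) => [/ind_on|/ind_off] ->. Qed.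

Let indD2pi x : adv_ind (x + 2 * pi) = adv_ind x.
Proof. by rewrite /adv_ind uD2pi. Qed.

Let MN : (M <= N)%N. Proof. by case/andP: M_bound => _ /ltnW. Qed.

Lemma gsum_ind (f : R -> R) : (forall x, f (x + 2 * pi) = f x) ->
  gsum (fun x => f x * adv_ind x) = \sum_(i < M) f ((p + i%:Z)%:~R * d).
Proof.
move=> fP; rewrite /gsum (@sum_grid_shift _ _ (fun x => f x * adv_ind x) p) //; last first.
  by move=> x; rewrite fP indD2pi.
rewrite -/d.
apply: (@sum_ord_support R N M
  (fun i => f ((p + i%:Z)%:~R * d) * adv_ind ((p + i%:Z)%:~R * d))
  (fun i => f ((p + i%:Z)%:~R * d))) => // i iM.
  by rewrite ind_on ?mulr1 // u_on.
by rewrite ind_off ?mulr0 // u_off.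
Qed.

Lemma gsum_ind1 : gsum adv_ind = M%:R.
Proof.
rewrite (_ : adv_ind = fun x => 1 * adv_ind x); last by apply/funext => x; rewrite mul1r.
by rewrite gsum_ind // sumr_const card_ord.
Qed.

(** At the grid point [i d], [0 <= i < N], the inner ReLU is [0] if [i < M] and at least [1]
    otherwise; the factor [2] then cancels [cos + 1 <= 2]. The summand [1] keeps the terms with
    [i < M] nonnegative. *)
Definition adv_z x : R :=
  relu (cos (x + d / 2) + 1 - 2 * relu (tmod x / d + 1 - M%:R)).

Let d_gt0 : 0 < d.
Proof. by rewrite /d divr_gt0 ?mulr_gt0 ?pi_gt0 ?ltr0n. Qed.

Lemma adv_layer2 x :
  layers adv_fno 2 u x = seq_cV 5 [:: u x; adv_ind x; adv_z x; M%:R; 0].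
Proof.
apply/colP => i; rewrite layersS (funext adv_layer1) adv_layerE mxE.
rewrite gsum_ind1 (@relu_id R 0) // (@relu_id R M%:R) // (relu_id (u_ge0 x)).
rewrite (relu_id (ind_ge0 x)) (relu_id (tmod_ge0 x)).
case: i => [[|[|[|[|[|//]]]]] ?] /=; rewrite !dotE /=
  !(mul0r, mulr0, oppr0, addr0, add0r, subr0, mul1r);
  try by rewrite !relu_id.
by rewrite /adv_z cosD; congr relu; ring.
Qed.

(** The surplus [M] is cancelled in the third layer by the channel that holds [M]. *)
Lemma gsum_z : gsum adv_z = \sum_(i < M) cos (i%:R * d + d / 2) + M%:R.
Proof.
have Nd : N%:R * d = 2 * pi by rewrite /d mulrC divfK // pnatr_eq0; lia.
rewrite /gsum (@sum_grid_shift _ _ adv_z 0) // -/d; last first.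
  move=> x; rewrite /adv_z tmodD2pi; congr (relu (_ + _ - _)).
  by rewrite addrAC mulr_natl cosD2pi.
rewrite (@sum_ord_support R N M (fun i => adv_z ((0 + i%:Z)%:~R * d))
  (fun i => cos (i%:R * d + d / 2) + 1)) //.
- by rewrite big_split /= sumr_const card_ord.
- move=> i iM; rewrite add0r -pmulrn /adv_z tmod_id; last first.
    rewrite mulr_ge0 ?ler0n ?ltW //= -Nd ltr_pM2r // ltr_nat.
    exact: leq_trans iM MN.
  rewrite mulfK ?gt_eqF // (@relu_0 R (i%:R + 1 - M%:R)); last first.
    by rewrite subr_le0 natr1 ler_nat.
  by rewrite mulr0 subr0 relu_id //; have := cos_geN1 (i%:R * d + d / 2); lra.
- move=> i /andP[iM iN]; rewrite add0r -pmulrn /adv_z tmod_id; last first.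
    by rewrite mulr_ge0 ?ler0n ?ltW //= -Nd ltr_pM2r // ltr_nat.
  rewrite mulfK ?gt_eqF //; have : (M%:R : R) <= i%:R by rewrite ler_nat.
  move=> Mi; rewrite (@relu_id R (i%:R + 1 - M%:R)); last by lra.
  by rewrite relu_0 //; have := cos_le1 (i%:R * d + d / 2); lra.
Qed.

Let D y : R := lam * threshold d p M y.

Lemma adv_layer3 x :
  layers adv_fno 3 u x = seq_cV 5 [:: u x; relu (D (x - d)); relu (D (x - d) - 1);
    relu (D (x - aT)); relu (D (x - aT) - 1)].
Proof.
(* Expanding [cos ((x - y) - t)] shows that the phase factors [cos t] and [sin t] translate the
   threshold by [t]. *)
have DE t : lam * M%:R - lam * gsum adv_z
   + (lam * cos t * gsum (fun y => cos (x - y) * adv_ind y)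
      + lam * sin t * gsum (fun y => sin (x - y) * adv_ind y)) = D (x - t).
  rewrite gsum_z gsum_ind; last first.
    by move=> y; rewrite opprD addrA -[in RHS](subrK (2 * pi) (x - y)) mulr_natl cosD2pi.
  rewrite gsum_ind; last first.
    by move=> y; rewrite opprD addrA -[in RHS](subrK (2 * pi) (x - y)) mulr_natl sinD2pi.
  rewrite /D /threshold.
  have -> : \sum_(i < M) cos (x - t - (p + i%:Z)%:~R * d) =
      cos t * (\sum_(i < M) cos (x - (p + i%:Z)%:~R * d))
      + sin t * (\sum_(i < M) sin (x - (p + i%:Z)%:~R * d)).
    rewrite !mulr_sumr -big_split /=; apply: eq_bigr => i _.
    by rewrite addrAC cosB; ring.
  ring.
apply/colP => i; rewrite layersS (funext adv_layer2) adv_layerE mxE.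
case: i => [[|[|[|[|[|//]]]]] ?] /=; rewrite !dotE /=
  !(mul0r, mulr0, oppr0, addr0, add0r, subr0, mul1r);
  first (by rewrite relu_id); congr relu; rewrite -DE; ring.
Qed.

Definition adv_first x : R := relu (u x - hh * clamp (D (x - d))).

Lemma adv_layer4 x :
  layers adv_fno 4 u x = seq_cV 5 [:: adv_first x; relu (clamp (D (x - aT))); 0; 0; 0].
Proof.
apply/colP => i; rewrite layersS (funext adv_layer3) adv_layerE mxE.
case: i => [[|[|[|[|[|//]]]]] ?] /=; rewrite !dotE /=
  !(mul0r, mulr0, oppr0, addr0, add0r, subr0, mul1r) ?(@relu_id R 0) //;
  congr relu; rewrite /clamp; ring.
Qed.

Lemma gsum_first : gsum adv_first = h.
Proof.
have Nd : N%:R * d = 2 * pi by rewrite /d mulrC divfK // pnatr_eq0; lia.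
have hh0 : 0 <= hh by exact: le_trans h_ge0 hh_ge.
have MN' := M_bound; have /andP[M0 MltN] := M_bound.
rewrite /gsum (@sum_grid_shift _ _ adv_first p) // -/d; last first.
  move=> x; rewrite /adv_first uD2pi /D addrAC.
  by rewrite -(thresholdD2piZ N p M (x - d) 1) mulr1.
rewrite (@sum_ord_support R N 1 (fun i => adv_first ((p + i%:Z)%:~R * d)) (fun=> h));
  [by rewrite big_ord_recl big_ord0 addr0|by lia| |].
- move=> [|//] _; rewrite /adv_first u_on // clamp_0.
    by rewrite mulr0 subr0 relu_id.
  (* The point before the window is taken one period later, at [(p + N - 1) d], the right end of the
     range in [threshold_off]. *)
  rewrite mulr_ge0_le0 ?slope_ge0 // -(thresholdD2piZ N p M _ 1) mulr1.
  apply: threshold_off => //; rewrite -/d -Nd addr0.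
  have : (M%:R + 1) * d <= N%:R * d by rewrite ler_pM2r // natr1 ler_nat.
  lra.
- move=> i /andP[i0 iN]; have := u_values ((p + i%:Z)%:~R * d).
  (* For [0 < i <= M] the window translated by [d] contains the point and [u - hh <= 0]; beyond [M],
     [u] is already [0]. *)
  rewrite /adv_first; case: (leqP i M) => iM uv.
    rewrite clamp_1 ?mulr1.
      by rewrite relu_0 // subr_le0; case: uv => ->.
    apply: threshold_on => //; rewrite -/d.
    have : 1 * d <= i%:R * d by rewrite ler_pM2r // ler1n.
    have : i%:R * d <= M%:R * d by rewrite ler_pM2r // ler_nat.
    by rewrite intrD -pmulrn; lra.
  rewrite u_off ?(ltnW iM) // relu_0 // sub0r oppr_le0 mulr_ge0 //.
  by case/andP: (clamp_itv (D ((p + i%:Z)%:~R * d - d))).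
Qed.

(** Subtraction replaces the product of [h] and the ramp: ramp [1] gives [h], ramp [0] gives
    [relu (h - hh) = 0]. *)
Lemma adv_evalE x :
  fno_eval adv_fno u x = relu (h + hh * (clamp (D (x - aT)) - 1)).
Proof.
rewrite /fno_eval [fno_L _]/= layersS (funext adv_layer4) mxE big_ord_recl.
rewrite big1 ?addr0; last by move=> i _; rewrite mxE /= nth_nil mul0r.
rewrite adv_layerE mxE mul1r !dotE /= -/gsum.
rewrite !(mul0r, mulr0, oppr0, addr0, add0r, subr0, mul1r).
rewrite gsum_first (@relu_id R (clamp _)); last by case/andP: (clamp_itv (D (x - aT))).
congr relu; ring.
Qed.

End AdvectionNetwork.

(** * The error for one input and its mean *)

Section Error.
Variable R : realType.

(** [p] rounds [lo / d] up and [p + M - 1] rounds [hi / d] down. The lower bound on the width gives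
    [M > 0], the upper one [M < N]. *)
Lemma window_grid (N : nat) (lo hi : R) (d := 2 * pi / N%:R) : (0 < N)%N ->
  d <= hi - lo -> hi - lo <= 2 * pi - 2 * d ->
  exists (p : int) (M : nat), [/\ (0 < M < N)%N,
    (p%:~R - 1) * d < lo <= p%:~R * d & (p%:~R + M%:R - 1) * d <= hi < (p%:~R + M%:R) * d].
Proof.
move=> N0 lw uw; have p0 := pi_gt0 R.
have N0' : (0 : R) < N%:R by rewrite ltr0n.
have d0 : 0 < d by rewrite /d divr_gt0 //; lra.
have Nd : N%:R * d = 2 * pi by rewrite /d mulrC divfK // gt_eqF.
pose p := Num.ceil (lo / d); pose q := Num.floor (hi / d).
have /andP[p1 p2] := Num.Theory.real_ceil_itv (num_real (lo / d)).
have /andP[q1 q2] := Num.Theory.real_floor_itv (num_real (hi / d)).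
rewrite -/p intrB in p1; rewrite -/p in p2; rewrite -/q in q1; rewrite -/q intrD in q2.
rewrite ltr_pdivlMr // in p1; rewrite ler_pdivrMr // in p2.
rewrite ler_pdivlMr // in q1; rewrite ltr_pdivrMr // in q2.
have pq : p <= q.
  rewrite -ltzD1 -(ltr_int R) intrD -(ltr_pM2r d0); lra.
have qp : q - p + 1 < N%:Z.
  have : (q - p + 2)%:~R * d < (N%:R + 1) * d by rewrite !intrD intrN; lra.
  by rewrite ltr_pM2r // natr1 (pmulrn 1 N.+1) ltr_int; lia.
have [M qpM] : exists M : nat, q - p + 1 = M%:Z by exists (absz (q - p + 1)); lia.
have MR : (M%:R : R) = q%:~R - p%:~R + 1 by rewrite (pmulrn 1 M) -qpM intrD intrB.
exists p, M; split; first by lia.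
- by rewrite p1 p2.
- by rewrite MR; lra.
Qed.

Lemma int_succ_cases (i j : int) : i <= j -> j <= i + 1 -> j = i \/ j = i + 1.
Proof. lia. Qed.

(** Each of the two bad cells of the circle is covered on [[0, 2 pi]] by two lifts, hence four
    intervals. *)
Lemma adv_L1dist_le (N : nat) (hl hh h w xi a T : R) (d := 2 * pi / N%:R) : (0 < N)%N ->
  0 < hl -> hl <= h -> h <= hh -> d <= w -> w <= 2 * pi - 2 * d ->
  (L1dist (Gadv a T (ubar h w xi))
     (fno_eval (adv_fno N hl hh (a * T)) (ubar h w xi)) <= (hh * (4 * d))%:E)%E.
Proof.
move=> N0 hl0 hlh hhh dw wd; have p0 := pi_gt0 R.
have N0' : (0 : R) < N%:R by rewrite ltr0n.
have d0 : 0 < d by rewrite /d divr_gt0 //; lra.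
have Nd : N%:R * d = 2 * pi by rewrite /d mulrC divfK // gt_eqF.
have [||p [M [MN /andP[p1 p2] /andP[q1 q2]]]] :=
  @window_grid N (xi - w / 2) (xi + w / 2) N0; [by rewrite -/d; lra|by rewrite -/d; lra|].
rewrite -/d in p1 p2 q1 q2.
set u := ubar h w xi.
have u_on y : p%:~R * d <= y <= (p%:~R + M%:R - 1) * d -> u y = h.
  by move=> /andP[y1 y2]; apply: ubar_on; lra.
have u_off y : (p%:~R + M%:R) * d <= y <= (p%:~R + N%:R - 1) * d -> u y = 0.
  by move=> /andP[y1 y2]; apply: ubar_off; lra.
have uv y : u y = h \/ u y = 0 by exact: ubar_cases.
have evalE x : fno_eval (adv_fno N hl hh (a * T)) u x =
    relu (h + hh * (clamp (slope R N * threshold d p M (x - a * T)) - 1)).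
  apply: adv_evalE => //.
  - by move=> y; exact: ubarD2pi.
  - move=> i iM; apply: u_on; rewrite -/d intrD -pmulrn.
    have : i%:R * d <= (M%:R - 1) * d by rewrite ler_pM2r // lerBrDr natr1 ler_nat.
    have : 0 <= i%:R * d by rewrite mulr_ge0 // ltW.
    lra.
  - move=> i /andP[iM iN]; apply: u_off; rewrite -/d intrD -pmulrn.
    have : i%:R * d <= (N%:R - 1) * d by rewrite ler_pM2r // lerBrDr natr1 ler_nat.
    have : M%:R * d <= i%:R * d by rewrite ler_pM2r // ler_nat.
    lra.
(* [c0] is the lift in [(-2 pi, 0]] of the first window point translated by [a * T]; on [[0, 2 pi]]
   only this period and the next occur. *)
pose n0 := Num.floor ((- (a * T) - p%:~R * d) / (2 * pi)).
pose c0 := a * T + 2 * pi * n0%:~R + p%:~R * d.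
pose c i := nth 0 [:: c0 + (M%:R - 1) * d; c0 + (M%:R - 1) * d + 2 * pi;
                      c0 + (N%:R - 1) * d; c0 + (N%:R - 1) * d + 2 * pi] i.
apply: (@integral_le_four_itv _ _ _ _ _ c) => //; [lra|lra| |].
- move=> x _; rewrite evalE /Gadv.
  have := uv (x - a * T); set k := clamp _.
  have /andP[k0 k1] : 0 <= k <= 1 by exact: clamp_itv.
  have r0 : 0 <= relu (h + hh * (k - 1)) by rewrite /relu le_max lexx orbT.
  have r1 : relu (h + hh * (k - 1)) <= h.
    by rewrite /relu ge_max; apply/andP; split; nra.
  by move: (relu _) r0 r1 => r r0 r1 [] ->; rewrite ler_norml; lra.
- move=> x; rewrite /= in_itv /= => /andP[x0 x1].
  pose n := Num.floor ((x - a * T - p%:~R * d) / (2 * pi)).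
  have pi2 : 0 < 2 * pi :> R by lra.
  have /andP[n1 n2] := Num.Theory.real_floor_itv
    (num_real ((x - a * T - p%:~R * d) / (2 * pi))).
  have /andP[n01 n02] := Num.Theory.real_floor_itv
    (num_real ((- (a * T) - p%:~R * d) / (2 * pi))).
  rewrite -/n ler_pdivlMr // in n1; rewrite -/n intrD ltr_pdivrMr // in n2.
  rewrite -/n0 ler_pdivlMr // in n01; rewrite -/n0 intrD ltr_pdivrMr // in n02.
  have n0n : n0 <= n.
    by rewrite -ltzD1 -(ltr_int R) intrD -(ltr_pM2r pi2); lra.
  have nn0 : n <= n0 + 1.
    by rewrite -ltzD1 -(ltr_int R) !intrD -(ltr_pM2r pi2); lra.
  (* Representative of [x - a * T] in the period that starts at [p d]. *)
  pose y := x - a * T - 2 * pi * n%:~R.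
  have xy : x - a * T = y + 2 * pi * n%:~R by rewrite /y; ring.
  have y1 : p%:~R * d <= y by rewrite /y; lra.
  have y2 : y < p%:~R * d + 2 * pi by rewrite /y; lra.
  (* [k = M] is the cell after the window; [k = N] is the cell before it, one period later. *)
  have bad (k : nat) : (k = M \/ k = N) -> (p%:~R + k%:R - 1) * d <= y <= (p%:~R + k%:R) * d ->
      exists2 i, (i < 4)%N & c i <= x <= c i + d.
    move=> kMN /andP[yk1 yk2].
    have [nE|nE] := int_succ_cases n0n nn0.
    + exists (if k == M then 0 else 2)%N; first by case: ifP.
      move: xy; rewrite nE => xy.
      by case: eqP kMN => [kM _|kM []// kN]; rewrite /c /= /c0; subst k; lra.
    + exists (if k == M then 1 else 3)%N; first by case: ifP.
      move: xy; rewrite nE intrD => xy.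
      by case: eqP kMN => [kM _|kM []// kN]; rewrite /c /= /c0; subst k; lra.
  rewrite evalE /Gadv xy thresholdD2piZ /u ubarD2piZ -/u.
  case: (lerP y ((p%:~R + M%:R - 1) * d)) => [yM|yM].
    left; rewrite u_on ?y1 // clamp_1; last by apply: threshold_on; rewrite ?y1.
    by rewrite subrr mulr0 addr0 relu_id ?subrr ?normr0 //; lra.
  case: (lerP y ((p%:~R + M%:R) * d)) => [yM'|yM'].
    by right; apply: (bad M); [left|rewrite yM' ltW].
  case: (lerP y ((p%:~R + N%:R - 1) * d)) => [yN|yN].
    left; rewrite u_off ?yN ?(ltW yM') // clamp_0; last first.
      by rewrite mulr_ge0_le0 ?slope_ge0 //; apply: threshold_off; rewrite ?yN ?(ltW yM').
    by rewrite relu_0 ?subrr ?normr0 //; lra.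
  by right; apply: (bad N); [right|rewrite (ltW yN); lra].
Qed.

(** The bound is uniform in [h], [w] and [xi], so it passes through the three means. *)
Lemma adv_error_le (N : nat) (hl hh wl wh a T : R) (d := 2 * pi / N%:R) : (0 < N)%N ->
  0 < hl -> hl <= hh -> wl <= wh -> d <= wl -> wh <= 2 * pi - 2 * d ->
  (adv_error hl hh wl wh a T (adv_fno N hl hh (a * T)) <= (hh * (4 * d))%:E)%E.
Proof.
move=> N0 hl0 hlh wlh dw wd; have p0 := pi_gt0 R.
pose e h w xi := L1dist (Gadv a T (ubar h w xi))
  (fno_eval (adv_fno N hl hh (a * T)) (ubar h w xi)).
have mean_xi h w : hl <= h <= hh -> wl <= w <= wh ->
    (0 <= unif_mean 0 (2 * pi) (e h w) <= (hh * (4 * d))%:E)%E.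
  move=> /andP[h1 h2] /andP[w1 w2]; apply: unif_mean_le => [|xi _|xi _]; first by lra.
    by apply: integral_ge0 => x _; rewrite lee_fin.
  by apply: adv_L1dist_le => //; rewrite -/d; lra.
have mean_w h : hl <= h <= hh ->
    (0 <= unif_mean wl wh (fun w => unif_mean 0 (2 * pi) (e h w)) <= (hh * (4 * d))%:E)%E.
  by move=> hP; apply: unif_mean_le => // w wP; have /andP[] := mean_xi h w hP wP.
have /andP[_] : (0 <= adv_error hl hh wl wh a T (adv_fno N hl hh (a * T))
    <= (hh * (4 * d))%:E)%E.
  by apply: unif_mean_le => // h hP; have /andP[] := mean_w h hP.
by [].
Qed.

End Error.

(** * Choice of the grid size and of the constant *)

Theorem theorem3p3 (R : realType) (hl hh wl wh a T : R) :
  0 < hl -> hl <= hh -> 0 < wl -> wl <= wh -> wh < 2 * pi -> 0 < T ->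
  exists C : R, 0 < C /\
    forall eps : R, 0 < eps -> eps <= 1 / 2 ->
      exists F : FNO R,
        (0 < fno_N F)%N /\ (fno_N F)%:R <= C / eps /\
        fno_kmax F = 1%N /\ (fno_dv F)%:R <= C /\
        (fno_L F)%:R <= C * (ln (eps^-1)) ^+ 2 /\
        (fno_size F)%:R <= C * (ln (eps^-1)) ^+ 2 /\
        (adv_error hl hh wl wh a T F <= eps%:E)%E.
Proof.
move=> hl0 hlh wl0 wlh whp _; have p0 := pi_gt0 R.
(* With [N eps > K], [eps <= 1] and [d = 2 pi / N], the three terms give in turn [4 hh d <= eps],
   [d <= wl] and [2 d <= 2 pi - wh]. *)
pose K := 8 * pi * hh + 2 * pi / wl + 4 * pi / (2 * pi - wh).
have K1 : 0 < 8 * pi * hh by rewrite !mulr_gt0 //; lra.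
have K2 : 0 < 2 * pi / wl by rewrite divr_gt0 //; lra.
have K3 : 0 < 4 * pi / (2 * pi - wh) by rewrite divr_gt0 //; lra.
have ln2 : 0 < ln (2 : R) by rewrite ln_gt0 // ltr1n.
(* The size does not depend on the grid, so grid size [1] stands for every [N]. *)
pose S : nat := fno_size (adv_fno 1 hl hh (a * T)).
have S0 : 0 <= S%:R / ln (2 : R) ^+ 2 by rewrite divr_ge0 // sqr_ge0.
have S5 : (5 <= S)%N by [].
(* The [5] bounds the lifting dimension and absorbs the rounding of [N]; the last term absorbs size
   and depth, as [ln (1 / eps) >= ln 2]. *)
exists (K + 5 + S%:R / ln 2 ^+ 2); split; first by rewrite /K; lra.
move=> eps e0 e1.
have Ke : 0 <= K / eps by rewrite divr_ge0 ?(ltW e0) //; rewrite /K; lra.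
pose N := (Num.truncn (K / eps)).+1.
have NK : K / eps < N%:R by exact: Num.Theory.truncnS_gt.
have KN : N%:R <= K / eps + 1.
  by rewrite -natr1 lerD2r Num.Theory.truncn_le.
have N0 : 0 < N%:R :> R by rewrite ltr0n.
have size_le : S%:R <= (K + 5 + S%:R / ln 2 ^+ 2) * (ln eps^-1) ^+ 2.
  have ln_le : ln 2 <= ln eps^-1 :> R.
    rewrite ler_ln ?posrE ?invr_gt0 // -[2]invrK lef_pV2 ?posrE ?invr_gt0 //; lra.
  have sq_le : ln (2 : R) ^+ 2 <= ln eps^-1 ^+ 2 by rewrite ler_sqr ?nnegrE //; lra.
  rewrite mulrDl; apply: (@le_trans _ _ (S%:R / ln 2 ^+ 2 * ln eps^-1 ^+ 2)).
    by rewrite -mulrA ler_peMr // mulrC ler_pdivlMr ?mul1r // exprn_gt0.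
  by rewrite lerDr mulr_ge0 ?sqr_ge0 //; rewrite /K; lra.
exists (adv_fno N hl hh (a * T)); do !split => //.
- rewrite [fno_N _]/=; apply: (le_trans KN).
  have s0 : 0 <= S%:R / ln (2 : R) ^+ 2 / eps by rewrite divr_ge0 // ltW.
  have e5 : 1 <= 5 / eps by rewrite ler_pdivlMr //; lra.
  by rewrite (mulrDl (K + 5)) (mulrDl K) -addrA lerD2l (le_trans e5) // lerDl.
- by rewrite [fno_dv _]/= /K; lra.
- by apply: le_trans size_le; rewrite ler_nat.
have KNe : K < N%:R * eps by rewrite -ltr_pdivrMr.
have NeN : N%:R * eps <= N%:R by rewrite ger_pMr //; lra.
apply: (@le_trans _ _ (hh * (4 * (2 * pi / N%:R)))%:E).
  apply: adv_error_le => //.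
    rewrite ler_pdivrMr // [leRHS]mulrC -ler_pdivrMr //; rewrite /K in KNe; lra.
  have : 4 * pi / N%:R <= 2 * pi - wh.
    rewrite ler_pdivrMr // [leRHS]mulrC -ler_pdivrMr ?subr_gt0 //; rewrite /K in KNe; lra.
  by lra.
rewrite lee_fin !mulrA ler_pdivrMr //; rewrite /K in KNe; lra.
Qed.
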